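(* Consider either problem $(\mathrm{QPI})$ or problem $(\mathrm{QPE})$, and suppose that the corresponding Slater condition holds: for $(\mathrm{QPI})$, for every $i\in\mathcal N$ there is $\hat x_i\in\mathbb R^{n_i}$ with $g_i(\hat x_i)<0$; for $(\mathrm{QPE})$, for every $i\in\mathcal N$ there are $\hat x_i^1,\hat x_i^2\in\mathbb R^{n_i}$ with $g_i(\hat x_i^1)<0$ and $g_i(\hat x_i^2)>0$. Suppose that $\widetilde b_i\in\operatorname{range}[\widetilde A_i]$ for every $i\in\mathcal N$. Assume furthermore that there exists a diagonal $(p+1)\times(p+1)$ matrix $D$ with diagonal entries $\pm1$ such that $DF_0D$ is a $Z$-matrix. Then the problem satisfies the $\mathcal S$-property.
   Context: Problem data. $\mathcal N=\{1,\dots,N\}$, $p=\sum_{i\in\mathcal N}n_i$, and $\mathbf x=(x_i)_{i\in\mathcal N}\in\mathbb R^p$ with blocks $x_i\in\mathbb R^{n_i}$. $A_0\in\mathbb R^{p\times p}$ is symmetric, $b_0\in\mathbb R^p$, $c_0\in\mathbb R$; for each $i\in\mathcal N$, $\widetilde A_i\in\mathbb R^{n_i\times n_i}$ is symmetric, $\widetilde b_i\in\mathbb R^{n_i}$, $c_i\in\mathbb R$. No definiteness is assumed. Put $f(\mathbf x)=\mathbf x^TA_0\mathbf x+2b_0^T\mathbf x+c_0$ and $g_i(x_i)=x_i^T\widetilde A_ix_i+2\widetilde b_i^Tx_i+c_i$. $(\mathrm{QPI})$ is: minimize $f(\mathbf x)$ over $\mathbf x\in\mathbb R^p$ subject to $g_i(x_i)\le0$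 for all $i\in\mathcal N$. $(\mathrm{QPE})$ is: minimize $f(\mathbf x)$ subject to $g_i(x_i)=0$ for all $i\in\mathcal N$. The symbol $\unlhd$ means $\le$ for $(\mathrm{QPI})$ and $=$ for $(\mathrm{QPE})$; $\Gamma=\mathbb R^N_+$ for $(\mathrm{QPI})$ and $\Gamma=\mathbb R^N$ for $(\mathrm{QPE})$. $\mathcal S$-property. The problem satisfies the $\mathcal S$-property if for every $\alpha\in\mathbb R$ the following two statements are equivalent: (1) for all $\mathbf x\in\mathbb R^p$, if $g_i(x_i)\unlhd0$ for all $i\in\mathcal N$ then $f(\mathbf x)\ge\alpha$; (2) there is $\boldsymbol\lambda=(\lambda_i)_{i\in\mathcal N}\in\Gamma$ such that $f(\mathbf x)+\sum_{i\in\mathcal N}\lambda_ig_i(x_i)\ge\alpha$ for all $\mathbf x\in\mathbb R^p$. Matrix $F_0$. Let $\overline A_0=\begin{pmatrix}A_0 & b_0 \\ b_0^T & c_0\end{pmatrix}$ and let $\overline E$ be the $(p+1)\times(p+1)$ matrix whose only nonzero entry is $(\overline E)_{p+1,p+1}=1$. For each $i$ fix a spectral decomposition $\widetilde A_i=Q_i\Delta_iQ_i^T$ ($Q_i$ orthogonal, $\Delta_i$ diagonal), let $S_i$ be the diagonal matrix with entries $|\delta|^{-1/2}$ where the corresponding diagonal entry $\delta$ of $\Delta_i$ is nonzero and $1$ where it is zero, and put $P_i=Q_iS_i$, $p_i=-\widetilde A_i^\dagger\widetilde b_i$ ($\dagger$ is the Moore–Penrose inverse). Let $P=\begin{pmatrix}\operatorname{diag}[P_1,\dots,P_N]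 & (p_1^T,\dots,p_N^T)^T \\ 0 & 1\end{pmatrix}$, an invertible $(p+1)\times(p+1)$ matrix, and $F_0=P^T(\overline A_0-\alpha\overline E)P$. Here $\alpha\in\mathbb R$ affects only the $(p+1,p+1)$ entry of $F_0$, so the condition on $DF_0D$ does not depend on $\alpha$. A $Z$-matrix is a symmetric matrix whose off-diagonal entries are all nonpositive. *)

(* Defs.v *)
From HB Require Import structures.
From mathcomp Require Import all_boot all_order all_algebra.
From mathcomp Require Import reals.

Set Implicit Arguments.
Unset Strict Implicit.
Unset Printing Implicit Defensive.

Import Order.TTheory GRing.Theory Num.Theory.

Local Open Scope ring_scope.

Definition quadfun (R : realType) (m : nat)
    (A : 'M[R]_m) (b : 'cV[R]_m) (c : R) (x : 'cV[R]_m) : R :=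
  (x^T *m A *m x) 0 0 + 2 * (b^T *m x) 0 0 + c.

Variant problem := QPI | QPE.

Definition constr (R : realType) (k : problem) (t : R) : Prop :=
  match k with QPI => t <= 0 | QPE => t = 0 end.

Definition in_Gamma (R : realType) (k : problem) (N : nat)
    (lambda : 'I_N -> R) : Prop :=
  match k with QPI => forall i, 0 <= lambda i | QPE => True end.

Definition slater (R : realType) (k : problem) (N : nat) (n : 'I_N -> nat)
    (g : forall i : 'I_N, 'cV[R]_(n i) -> R) : Prop :=
  match k with
  | QPI => forall i, exists x : 'cV[R]_(n i), g i x < 0
  | QPE => forall i,
      exists x1 : 'cV[R]_(n i), exists x2 : 'cV[R]_(n i), g i x1 < 0 /\ 0 < g i x2
  end.

Definition S_property (R : realType) (k : problem) (N : nat) (n : 'I_N -> nat)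
    (f : 'cV[R]_(\sum_(i < N) n i) -> R)
    (g : forall i : 'I_N, 'cV[R]_(n i) -> R) : Prop :=
  forall alpha : R,
    (forall x : 'cV[R]_(\sum_(i < N) n i),
        (forall i, constr k (g i (submxcol x i))) -> alpha <= f x)
    <->
    (exists lambda : 'I_N -> R, in_Gamma k lambda /\
      forall x : 'cV[R]_(\sum_(i < N) n i),
        alpha <= f x + \sum_(i < N) lambda i * g i (submxcol x i)).

(* The four Penrose equations, which determine X uniquely from A. *)
Definition is_moore_penrose (R : realType) (m : nat) (A X : 'M[R]_m) : Prop :=
  [/\ A *m X *m A = A, X *m A *m X = X,
      (A *m X)^T = A *m X & (X *m A)^T = X *m A].

Definition is_spectral_decomp (R : realType) (m : nat)
    (A Q : 'M[R]_m) (delta : 'rV[R]_m) : Prop :=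
  Q^T *m Q = 1%:M /\ A = Q *m diag_mx delta *m Q^T.

Definition scaling_mx (R : realType) (m : nat) (delta : 'rV[R]_m) : 'M[R]_m :=
  diag_mx (\row_j (if delta 0 j == 0 then 1 else (Num.sqrt `|delta 0 j|)^-1)).

Definition A0bar (R : realType) (p : nat)
    (A0 : 'M[R]_p) (b0 : 'cV[R]_p) (c0 : R) : 'M[R]_(p + 1) :=
  block_mx A0 b0 b0^T c0%:M.

Definition Ebar (R : realType) (p : nat) : 'M[R]_(p + 1) :=
  delta_mx (rshift p ord0) (rshift p ord0).

Definition Pmx (R : realType) (N : nat) (n : 'I_N -> nat)
    (Q : forall i : 'I_N, 'M[R]_(n i)) (delta : forall i : 'I_N, 'rV[R]_(n i))
    (Adag : forall i : 'I_N, 'M[R]_(n i)) (bt : forall i : 'I_N, 'cV[R]_(n i)) :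
    'M[R]_(\sum_(i < N) n i + 1) :=
  block_mx (\mxdiag_(i < N) (Q i *m scaling_mx (delta i)))
           (\mxcol_(i < N) (- (Adag i *m bt i)))
           0 1%:M.

Definition F0 (R : realType) (p : nat) (A0 : 'M[R]_p) (b0 : 'cV[R]_p) (c0 : R)
    (P : 'M[R]_(p + 1)) (alpha : R) : 'M[R]_(p + 1) :=
  P^T *m (A0bar A0 b0 c0 - alpha *: Ebar R p) *m P.

Definition is_Zmatrix (R : realType) (m : nat) (M : 'M[R]_m) : Prop :=
  M^T = M /\ forall i j : 'I_m, i != j -> M i j <= 0.

Definition is_signature (R : realType) (m : nat) (D : 'M[R]_m) : Prop :=
  is_diag_mx D /\ forall i : 'I_m, D i i = 1 \/ D i i = -1.

(* Main.v *)
Require Import Defs.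
From HB Require Import structures.
From mathcomp Require Import all_boot all_order all_algebra.
From mathcomp Require Import reals.
From mathcomp Require Import ring lra.

Set Implicit Arguments.
Unset Strict Implicit.
Unset Printing Implicit Defensive.

Import Order.TTheory GRing.Theory Num.Theory.

Local Open Scope ring_scope.

(* In the coordinates [x = diag(P_i) y + p], each constraint is affine in the
   squares of the coordinates of [y], and the objective is the quadratic form of
   [F0] in [(y, 1)].  Given two points and a weight [t], let the squares be
   averaged and take square roots with the signs prescribed by [D]: the
   constraints are averaged exactly, and by Cauchy-Schwarz together with the
   nonpositive off-diagonal entries of [D F0 D] the objective lies below the
   average.  So the problem is convexlike, and Lagrange multipliers exist under
   Slater's condition.  Since each constraint involves its own block only, they
   can be dualized one at a time, which requires only the completeness of [R]
   instead of a separation theorem. *)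

(** * Multipliers for convexlike problems *)

Definition convexlike (R : realType) (X I : Type) (A : X -> Prop) (f : X -> R)
    (g : I -> X -> R) :=
  forall x y t, A x -> A y -> 0 <= t <= 1 ->
  exists2 z, A z & f z <= (1 - t) * f x + t * f y /\
    forall i, g i z = (1 - t) * g i x + t * g i y.

Lemma constr_convex (R : realType) (k : problem) (a b t : R) : 0 <= t <= 1 ->
  constr k a -> constr k b -> constr k ((1 - t) * a + t * b).
Proof.
case: k => /= t01 a0 b0; last by rewrite a0 b0 !mulr0 addr0.
by case/andP: t01 => t0 t1; nra.
Qed.

(* The multiplier is the supremum of the slopes [(alpha - f x) / h x] over the
   points with [0 < h x]; the points with [h y < 0] bound these slopes above
   because [h] vanishes somewhere between [x] and [y]. *)
Lemma multiplier1 (R : realType) (X : Type) (k : problem) (A : X -> Prop)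
    (f h : X -> R) (alpha : R) :
  convexlike A f (fun _ : unit => h) ->
  (exists2 x, A x & h x < 0) ->
  (k = QPE -> exists2 x, A x & 0 < h x) ->
  (forall x, A x -> constr k (h x) -> alpha <= f x) ->
  exists2 l, (k = QPI -> 0 <= l) & forall x, A x -> alpha <= f x + l * h x.
Proof.
move=> cvx [x0 Ax0 hx0] pos feas.
(* For [QPI], adjoining 0 makes the supremum nonnegative and keeps the set nonempty even if [h] is
   nowhere positive; for [QPE], [pos] gives nonemptiness. *)
pose E r := (k = QPI /\ r = 0) \/
  exists x, [/\ A x, 0 < h x & r = (alpha - f x) / h x].
have constr0 : constr k (0 : R) by case: (k) => /=; rewrite ?lexx.
have E_le y r : A y -> h y < 0 -> E r -> r <= (f y - alpha) / - h y.
  move=> Ay hy; rewrite ler_pdivlMr ?oppr_gt0 // => -[[kI ->]|[x [Ax hx ->]]].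
    rewrite mul0r subr_ge0; apply: feas => //.
    by rewrite kI /=; exact: ltW.
  have d0 : 0 < h x - h y by lra.
  (* The weight at which the average of [h x] and [h y] vanishes. *)
  pose t := h x / (h x - h y).
  have t01 : 0 <= t <= 1.
    by rewrite /t ler_pdivlMr // ler_pdivrMr // mul0r mul1r; apply/andP; split; lra.
  have [z Az [fz hz]] := cvx x y t Ax Ay t01.
  have hz0 : h z = 0 by rewrite (hz tt) /t; field; rewrite gt_eqF.
  have : alpha <= f z by apply: feas => //; rewrite hz0.
  move=> /le_trans /(_ fz).
  have -> : (1 - t) * f x + t * f y = (h x * f y - h y * f x) / (h x - h y).
    by rewrite /t; field; rewrite gt_eqF.
  rewrite ler_pdivlMr // => le_comb.
  by rewrite mulrAC ler_pdivrMr //; clear -le_comb; lra.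
have E0 : exists r, E r.
  have kP : k = QPI \/ k = QPE by case: (k); [left|right].
  case: kP => [kI|kE]; first by exists 0; left.
  by have [x Ax hx] := pos kE; exists ((alpha - f x) / h x); right; exists x.
have E_sup r : E r -> r <= sup E.
  apply: ub_le_sup; exists ((f x0 - alpha) / - h x0) => s Es.
  exact: E_le Es.
exists (sup E) => [kI|x Ax]; first by apply: E_sup; left.
have [hx|hx|hx] := ltgtP (h x) 0.
- suff : sup E <= (f x - alpha) / - h x by rewrite ler_pdivlMr ?oppr_gt0 //; lra.
  by apply: ge_sup => // r Er; apply: E_le.
- have : (alpha - f x) / h x <= sup E by apply: E_sup; right; exists x.
  by rewrite ler_pdivrMr //; lra.
- by rewrite hx mulr0 addr0; apply: feas => //; rewrite hx.
Qed.

(** Induction on the list [s] of constraints already dualized, the others still being imposed. To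
    add [i], apply [multiplier1] to the Lagrangian of [s] on the points meeting the constraints
    outside [i :: s]; the Slater points lie there because they satisfy all constraints other than
    [i]. *)
Lemma multipliers (R : realType) (X : Type) (k : problem) (I : finType)
    (f : X -> R) (g : I -> X -> R) (alpha : R) :
  convexlike (fun=> True) f g ->
  (forall i, exists2 x, g i x < 0 & forall j, j != i -> constr k (g j x)) ->
  (k = QPE ->
    forall i, exists2 x, 0 < g i x & forall j, j != i -> constr k (g j x)) ->
  (forall x, (forall i, constr k (g i x)) -> alpha <= f x) ->
  exists2 l : I -> R, (k = QPI -> forall i, 0 <= l i) &
    forall x, alpha <= f x + \sum_i l i * g i x.
Proof.
move=> cvx neg pos feas.
suff /(_ (index_enum I) (index_enum_uniq I)) [l l0 lP] : forall s : seq I, uniq s ->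
    exists2 l : I -> R, (k = QPI -> forall i, 0 <= l i) &
    forall x, (forall i, i \notin s -> constr k (g i x)) ->
      alpha <= f x + \sum_(i <- s) l i * g i x.
  by exists l => // x; apply: lP => i; rewrite mem_index_enum.
elim=> [_|i s IHs /andP[i_s /IHs[l l0 lP]]].
  exists (fun=> 0) => // x xP; rewrite big_nil addr0.
  by apply: feas => i; exact: xP.
pose A x := forall j, j \notin i :: s -> constr k (g j x).
pose phi x := f x + \sum_(j <- s) l j * g j x.
have Ai (x : X) : (forall j, j != i -> constr k (g j x)) -> A x.
  by move=> xP j; rewrite inE negb_or => /andP[/xP].
have [||||m m0 mP] := @multiplier1 R X k A phi (g i) alpha.
(* Constraint values are averaged exactly, so [z] stays in [A] and the sum weighted by [l] is
   averaged whatever the signs of [l]. *)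
- move=> x y t Ax Ay t01.
  have [z _ [fz gz]] := cvx x y t Logic.I Logic.I t01.
  exists z => [j js|]; first by rewrite gz; apply: constr_convex; auto.
  split=> //; rewrite /phi.
  have -> : \sum_(j <- s) l j * g j z =
      (1 - t) * (\sum_(j <- s) l j * g j x) + t * (\sum_(j <- s) l j * g j y).
    rewrite !mulr_sumr -big_split; apply: eq_bigr => j _ /=.
    by rewrite gz; ring.
  by lra.
- by have [x gx /Ai] := neg i; exists x.
- by move=> /pos/(_ i)[x gx /Ai]; exists x.
- move=> x Ax gix; apply: lP => j js.
  have [->//|ji] := eqVneq j i.
  by apply: Ax; rewrite inE negb_or ji.
exists (fun j => if j == i then m else l j) => [kI j|x xP].
  by case: ifP => _; [exact: m0|exact: l0].
rewrite big_cons eqxx addrCA.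
rewrite (eq_big_seq (fun j => l j * g j x)) => [|j js].
  by rewrite addrC; exact: mP.
by case: eqP js i_s => // -> ->.
Qed.

(** * Averaging squares of coordinates in a quadratic form *)

Lemma sqrt_comb_ge (R : rcfType) (t a b a' b' : R) : 0 <= t <= 1 ->
  (1 - t) * (a * b) + t * (a' * b') <=
  Num.sqrt ((1 - t) * a ^+ 2 + t * a' ^+ 2) *
  Num.sqrt ((1 - t) * b ^+ 2 + t * b' ^+ 2).
Proof.
move=> /andP[t0 t1]; have t1' : 0 <= 1 - t by rewrite subr_ge0.
have comb_ge0 u v : 0 <= (1 - t) * u ^+ 2 + t * v ^+ 2.
  by rewrite addr_ge0 // mulr_ge0 ?sqr_ge0.
rewrite -sqrtrM //; apply: le_trans (ler_norm _) _; rewrite -sqrtr_sqr.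
rewrite ler_wsqrtr // -subr_ge0; set d := (X in 0 <= X).
(* Lagrange's identity: the defect in the Cauchy-Schwarz inequality with weights [1 - t] and [t]. *)
have -> : d = t * (1 - t) * (a * b' - a' * b) ^+ 2 by rewrite /d; ring.
by rewrite mulr_ge0 ?sqr_ge0 // mulr_ge0.
Qed.

Lemma bilinE (R : comPzRingType) (m : nat) (M : 'M[R]_m) (u v : 'cV[R]_m) :
  (u^T *m M *m v) 0 0 = \sum_j \sum_i M i j * (u i 0 * v j 0).
Proof.
rewrite !mxE; apply: eq_bigr => j _; rewrite !mxE mulr_suml.
by apply: eq_bigr => i _; rewrite !mxE mulrA (mulrC (M i j)).
Qed.

Lemma quadform_diag (R : comPzRingType) (m : nat) (e : 'rV[R]_m) (v : 'cV[R]_m) :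
  (v^T *m diag_mx e *m v) 0 0 = \sum_j e 0 j * v j 0 ^+ 2.
Proof.
rewrite mul_mx_diag mxE; apply: eq_bigr => j _.
by rewrite !mxE mulrAC mulrC expr2.
Qed.

(** Diagonal terms are averaged exactly, whatever their sign, since [w j 0 ^+ 2] is the average of
    the squares. Off the diagonal, the nonpositive factor [d i * M i j * d j] reverses
    Cauchy-Schwarz. *)
Lemma quadform_Zmatrix_convex (R : rcfType) (m : nat) (M : 'M[R]_m) (d : 'I_m -> R)
    (t : R) (u v w : 'cV[R]_m) :
  0 <= t <= 1 -> (forall j, d j ^+ 2 = 1) ->
  (forall i j, i != j -> d i * M i j * d j <= 0) ->
  (forall j, w j 0 = d j * Num.sqrt ((1 - t) * u j 0 ^+ 2 + t * v j 0 ^+ 2)) ->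
  (w^T *m M *m w) 0 0 <=
    (1 - t) * (u^T *m M *m u) 0 0 + t * (v^T *m M *m v) 0 0.
Proof.
move=> t01 d1 M0 wE; rewrite !bilinE !mulr_sumr -big_split ler_sum // => j _ /=.
rewrite !mulr_sumr -big_split ler_sum // => i _ /=; rewrite !wE.
have [->|ij] := eqVneq i j.
  rewrite mulrACA -!expr2 d1 mul1r sqr_sqrtr; first by lra.
  by case/andP: t01 => t0 t1; rewrite addr_ge0 // mulr_ge0 ?sqr_ge0 ?subr_ge0.
(* Scaling the coordinates by the signs leaves the square roots unchanged and cancels the signs in
   [d i * M i j * d j]. *)
have := sqrt_comb_ge (d i * u i 0) (d j * u j 0) (d i * v i 0) (d j * v j 0) t01.
rewrite !exprMn !d1 !mul1r => /(ler_wnM2l (M0 i j ij)); congr (_ <= _); first by ring.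
transitivity (d i ^+ 2 * d j ^+ 2 *
  ((1 - t) * (M i j * (u i 0 * u j 0)) + t * (M i j * (v i 0 * v j 0)))).
  by ring.
by rewrite !d1 !mul1r.
Qed.

(** * Homogenization and change of coordinates *)

Lemma quadfun_homogeneous (R : realType) (p : nat) (A : 'M[R]_p) (b : 'cV[R]_p)
    (c alpha : R) (x : 'cV[R]_p) :
  quadfun A b c x - alpha =
  ((col_mx x 1%:M)^T *m (A0bar A b c - alpha *: Ebar R p) *m col_mx x 1%:M) 0 0.
Proof.
have -> : A0bar A b c - alpha *: Ebar R p = block_mx A b b^T (c - alpha)%:M.
  rewrite /A0bar /Ebar delta_mx_dshift delta_mx_rshift -(row_mx0 _ _ p 1).
  rewrite -/(block_mx 0 0 0 (delta_mx ord0 ord0)) scale_block_mx opp_block_mx.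
  rewrite add_block_mx.
  rewrite !scaler0 !subr0; congr block_mx.
  by apply/matrixP => i j; rewrite !mxE !ord1 /= mulr1.
rewrite tr_col_mx mul_row_block mul_row_col trmx1 !mul1mx mulmx1 mulmxDl.
have addE (U V : 'M[R]_1) : (U + V) 0 0 = U 0 0 + V 0 0 by rewrite mxE.
have -> : x^T *m b = b^T *m x.
  by rewrite [RHS]mx11_scalar -tr_scalar_mx -mx11_scalar trmx_mul trmxK.
by rewrite !addE /quadfun [_%:M 0 0]mxE eqxx mulr1n; ring.
Qed.

(** Completing the square: [p] is a critical point, so the terms linear in [y] cancel, and the
    congruence by [B] diagonalizes what remains. *)
Lemma quadfun_centered (R : realType) (m : nat) (A B : 'M[R]_m) (b p : 'cV[R]_m)
    (c : R) (e : 'rV[R]_m) (y : 'cV[R]_m) :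
  A^T = A -> A *m p + b = 0 -> B^T *m A *m B = diag_mx e ->
  quadfun A b c (B *m y + p) = \sum_j e 0 j * y j 0 ^+ 2 + quadfun A b c p.
Proof.
move=> At Ap Be; rewrite -quadform_diag -Be /quadfun.
have -> : b = - (A *m p) by apply/eqP; rewrite -addr_eq0 addrC Ap.
rewrite [(_ + p)^T]linearD linearN /= !trmx_mul At !(mulmxDl, mulmxDr, mulNmx, mulmxA).
have -> : y^T *m B^T *m A *m p = (p^T *m A *m B *m y)^T.
  by rewrite !trmx_mul trmxK At !mulmxA.
have addE (U V : 'M[R]_1) : (U + V) 0 0 = U 0 0 + V 0 0 by rewrite mxE.
have oppE (U : 'M[R]_1) : (- U) 0 0 = - U 0 0 by rewrite mxE.
have trE (U : 'M[R]_1) : U^T 0 0 = U 0 0 by rewrite mxE.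
by rewrite !addE !oppE !trE; ring.
Qed.

Lemma scaling_mx_unit (R : realType) (m : nat) (delta : 'rV[R]_m) :
  scaling_mx delta \in unitmx.
Proof.
rewrite unitmxE det_diag unitfE; apply/prodf_neq0 => j _; rewrite mxE.
have [_|dj] := eqVneq (delta 0 j); first exact: oner_neq0.
by rewrite invr_eq0 sqrtr_eq0 -ltNge normr_gt0.
Qed.

Lemma spectral_scaling_diag (R : realType) (m : nat) (A Q : 'M[R]_m)
    (delta : 'rV[R]_m) : is_spectral_decomp A Q delta ->
  exists e : 'rV[R]_m,
    (Q *m scaling_mx delta)^T *m A *m (Q *m scaling_mx delta) = diag_mx e.
Proof.
case=> QQ ->; apply/diag_mxP; rewrite trmx_mul tr_diag_mx !mulmxA.
rewrite -[_ *m Q^T *m Q]mulmxA -[_ *m Q^T *m Q]mulmxA QQ !mulmx1 !mulmx_diag.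
exact: diag_mx_is_diag.
Qed.

Lemma Pmx_homogeneous (R : realType) (N : nat) (n : 'I_N -> nat)
    (Q : forall i : 'I_N, 'M[R]_(n i)) (delta : forall i : 'I_N, 'rV[R]_(n i))
    (Adag : forall i : 'I_N, 'M[R]_(n i)) (bt : forall i : 'I_N, 'cV[R]_(n i))
    (y : 'cV[R]_(\sum_(i < N) n i)) :
  Pmx Q delta Adag bt *m col_mx y 1%:M =
  col_mx (\mxcol_i (Q i *m scaling_mx (delta i) *m submxcol y i - Adag i *m bt i))
    1%:M.
Proof.
rewrite mul_block_col mul0mx add0r !mulmx1; congr col_mx.
rewrite -{1}[y]submxcolK mul_mxdiag_mxcol.
by apply/mxcolP => i; rewrite submxcolD !mxcolK.
Qed.

(** * Convexlikeness from the sign condition *)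

Lemma quadfun_convexlike (R : realType) (N : nat) (n : 'I_N -> nat)
    (A0 : 'M[R]_(\sum_(i < N) n i)) (b0 : 'cV[R]_(\sum_(i < N) n i)) (c0 : R)
    (At : forall i : 'I_N, 'M[R]_(n i)) (bt : forall i : 'I_N, 'cV[R]_(n i))
    (c : 'I_N -> R)
    (Q : forall i : 'I_N, 'M[R]_(n i)) (delta : forall i : 'I_N, 'rV[R]_(n i))
    (Adag : forall i : 'I_N, 'M[R]_(n i)) (alpha : R)
    (At_sym : forall i, (At i)^T = At i)
    (spectral : forall i, is_spectral_decomp (At i) (Q i) (delta i))
    (pinv : forall i, is_moore_penrose (At i) (Adag i))
    (bt_range : forall i, exists y : 'cV[R]_(n i), bt i = At i *m y)
    (signZ : exists D : 'M[R]_(\sum_(i < N) n i + 1),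
      is_signature D /\
      is_Zmatrix (D *m F0 A0 b0 c0 (Pmx Q delta Adag bt) alpha *m D)) :
  convexlike (fun=> True) (quadfun A0 b0 c0)
    (fun i x => quadfun (At i) (bt i) (c i) (submxcol x i)).
Proof.
pose B i := Q i *m scaling_mx (delta i); pose p i := - (Adag i *m bt i).
pose X y := \mxcol_i (B i *m submxcol y i + p i).
have X_surj x : exists y, x = X y.
  exists (\mxcol_i (invmx (B i) *m (submxcol x i - p i))).
  apply/mxcolP => i.
  rewrite !mxcolK mulKVmx ?subrK // unitmx_mul scaling_mx_unit andbT.
  by have [QQ _] := spectral i; have [] := mulmx1_unit QQ.
have [D [[/diag_mxP[d ->] dd] [_]]] := signZ.
set M := F0 _ _ _ _ _ => MZ.
have fE y : quadfun A0 b0 c0 (X y) =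
    ((col_mx y 1%:M)^T *m M *m col_mx y 1%:M) 0 0 + alpha.
  apply/eqP; rewrite -subr_eq quadfun_homogeneous /M /F0.
  by rewrite -Pmx_homogeneous trmx_mul !mulmxA.
clearbody M.
have [e eE] := fin_all_exists (fun i => spectral_scaling_diag (spectral i)).
have gE i y : quadfun (At i) (bt i) (c i) (submxcol (X y) i) =
    \sum_j e i 0 j * submxcol y i j 0 ^+ 2 + quadfun (At i) (bt i) (c i) (p i).
  rewrite mxcolK; apply: (quadfun_centered _ _ (At_sym i) _ (eE i)).
  (* With [bt i] in the range of [At i], the Penrose equation [A X A = A] makes [p i] a critical
     point of the constraint. *)
  rewrite /p; have [z ->] := bt_range i; have [AXA _ _ _] := pinv i.
  by rewrite mulmxN !mulmxA AXA addNr.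
have d1 j : d 0 j ^+ 2 = 1.
  by have := dd j; rewrite mxE eqxx mulr1n => -[] ->; rewrite ?sqrrN expr1n.
move=> x x' t _ _ t01.
have [[u ->] [v ->]] := (X_surj x, X_surj x').
pose U : 'cV[R]_(_ + 1) := col_mx u 1%:M; pose V : 'cV[R]_(_ + 1) := col_mx v 1%:M.
pose l := rshift (\sum_(i < N) n i) (ord0 : 'I_1).
(* The factor [d 0 l] makes the last homogeneous coordinate of [W] equal to 1. *)
pose dl j := d 0 l * d 0 j.
pose W := \col_j (dl j * Num.sqrt ((1 - t) * U j 0 ^+ 2 + t * V j 0 ^+ 2)).
have WE : W = col_mx (usubmx W) 1%:M.
  rewrite -[LHS]vsubmxK; congr col_mx; apply/matrixP => i j.
  rewrite !ord1 [dsubmx W _ _]mxE [W _ _]mxE /U /V !col_mxEd !mxE.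
  (* [U] and [V] both end in 1, so the root is that of [(1 - t) + t = 1]. *)
  rewrite eqxx !expr1n !mulr1 subrK sqrtr1 mulr1.
  by rewrite /dl -expr2 d1.
have sqr_dl j : dl j ^+ 2 = 1 by rewrite /dl exprMn !d1 mulr1.
have sqrW j : W j 0 ^+ 2 = (1 - t) * U j 0 ^+ 2 + t * V j 0 ^+ 2.
  rewrite mxE exprMn sqr_dl mul1r sqr_sqrtr //; case/andP: t01 => t0 t1.
  by rewrite addr_ge0 // mulr_ge0 ?sqr_ge0 ?subr_ge0.
exists (X (usubmx W)) => //; split=> [|i].
  rewrite !fE -WE.
  have : (W^T *m M *m W) 0 0 <=
      (1 - t) * (U^T *m M *m U) 0 0 + t * (V^T *m M *m V) 0 0.
    apply: (@quadform_Zmatrix_convex _ _ M dl t U V W t01 sqr_dl) => [i j ij|j];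
      last by rewrite mxE.
    (* Multiplying all signs by [d 0 l] leaves the products of two signs unchanged. *)
    have := MZ i j ij; rewrite mul_mx_diag mul_diag_mx !mxE.
    rewrite [dl i * _ * _](_ : _ = d 0 l ^+ 2 * (d 0 i * M i j * d 0 j)).
      by rewrite d1 mul1r.
    by rewrite /dl; ring.
  by rewrite -/U -/V; lra.
rewrite !gE [RHS](_ : _ =
    (1 - t) * (\sum_j e i 0 j * submxcol u i j 0 ^+ 2) +
    t * (\sum_j e i 0 j * submxcol v i j 0 ^+ 2) +
    quadfun (At i) (bt i) (c i) (p i)); last by ring.
congr (_ + _); rewrite !mulr_sumr -big_split; apply: eq_bigr => j _ /=.
rewrite [submxcol (usubmx W) i j 0]mxE [usubmx W _ _]mxE sqrW /U /V !col_mxEu.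
by rewrite [submxcol u i j 0]mxE [submxcol v i j 0]mxE; ring.
Qed.

(** * From blockwise Slater points to the S-property *)

Theorem theorem4 (R : realType) (k : problem) (N : nat) (n : 'I_N -> nat)
    (A0 : 'M[R]_(\sum_(i < N) n i)) (b0 : 'cV[R]_(\sum_(i < N) n i)) (c0 : R)
    (At : forall i : 'I_N, 'M[R]_(n i)) (bt : forall i : 'I_N, 'cV[R]_(n i))
    (c : 'I_N -> R)
    (Q : forall i : 'I_N, 'M[R]_(n i)) (delta : forall i : 'I_N, 'rV[R]_(n i))
    (Adag : forall i : 'I_N, 'M[R]_(n i)) (alpha : R)
    (A0_sym : A0^T = A0)
    (At_sym : forall i, (At i)^T = At i)
    (spectral : forall i, is_spectral_decomp (At i) (Q i) (delta i))
    (pinv : forall i, is_moore_penrose (At i) (Adag i))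
    (slater_cond : slater k (fun i => quadfun (At i) (bt i) (c i)))
    (bt_range : forall i, exists y : 'cV[R]_(n i), bt i = At i *m y)
    (signZ : exists D : 'M[R]_(\sum_(i < N) n i + 1),
      is_signature D /\
      is_Zmatrix (D *m F0 A0 b0 c0 (Pmx Q delta Adag bt) alpha *m D)) :
  S_property k (quadfun A0 b0 c0) (fun i => quadfun (At i) (bt i) (c i)).
Proof.
pose g i := quadfun (At i) (bt i) (c i).
have cvx :
    convexlike (fun=> True) (quadfun A0 b0 c0) (fun i x => g i (submxcol x i)).
  exact: quadfun_convexlike signZ.
have [neg pos] : (forall i, exists x, g i x < 0) /\
    (k = QPE -> forall i, exists x, 0 < g i x).
  move: slater_cond; case: (k) => /= sl; first by split.
  by split=> [i|_ i]; have [x1 [x2 []]] := sl i; [exists x1|exists x2].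
have [a aP] : exists a : forall i, 'cV[R]_(n i), forall i, constr k (g i (a i)).
  move: slater_cond pos; case: (k) => /= sl pos.
    by have [a aP] := fin_all_exists sl; exists a => i; exact: ltW (aP i).
  have [[a1 a1P] [a2 a2P]] := (fin_all_exists neg, fin_all_exists (pos erefl)).
  suff /fin_all_exists : forall i, exists x, g i x = 0 by [].
  move=> i; have [g1 g2] := (a1P i, a2P i).
  have d0 : 0 < g i (a2 i) - g i (a1 i) by lra.
  (* The weight at which the average of a negative and a positive value vanishes; exact averaging
     stands in for the intermediate value theorem. *)
  pose t := - g i (a1 i) / (g i (a2 i) - g i (a1 i)).
  have t01 : 0 <= t <= 1.
    rewrite /t ler_pdivlMr // ler_pdivrMr // mul0r mul1r.
    by apply/andP; split; lra.
  have [z _ [_ gz]] :=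
    cvx (\mxcol_j a1 j) (\mxcol_j a2 j) t Logic.I Logic.I t01.
  have := gz i; rewrite !mxcolK => giz; exists (submxcol z i).
  by rewrite giz /t; field; rewrite gt_eqF.
(* Replacing only block [i] of the feasible point [a] keeps all other constraints satisfied, which
   turns blockwise Slater points into those that [multipliers] asks for. *)
pose repl i (x : 'cV[R]_(n i)) : 'cV[R]_(\sum_(i < N) n i) :=
  \mxcol_j dfwith a x j.
have repl_i i x : g i (submxcol (repl i x) i) = g i x.
  by rewrite mxcolK dfwith_in.
have repl_ne i x j : j != i -> constr k (g j (submxcol (repl i x) j)).
  by move=> ji; rewrite mxcolK dfwith_out // eq_sym.
(* [cvx] does not mention [alpha], so it serves every threshold [beta]. *)
move=> beta; split=> [feas|[l [l0 lP]] x xP].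
- have [||l l0 lP] := multipliers cvx _ _ feas.
  + by move=> i; have [x gx] := neg i; exists (repl i x) => /=;
      [rewrite repl_i|exact: repl_ne].
  + by move=> kE i; have [x gx] := pos kE i; exists (repl i x) => /=;
      [rewrite repl_i|exact: repl_ne].
  by exists l; split=> //; move: l0; case: (k) => //= /(_ erefl).
- apply: le_trans (lP x) _; rewrite gerDl sumr_le0 // => i _.
  move: l0 (xP i); case: (k) => /= [l0 gi|_ ->]; last by rewrite mulr0.
  exact: mulr_ge0_le0.
Qed.
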